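(* For $\mathbf u^\pm\in\Omega^a$ and $\mathbf n\in\mathbb R^d$ a unit vector, define the two-point numerical flux $$\mathbf h_{ec}(\mathbf u^-,\mathbf u^+,\mathbf n)=\begin{pmatrix}h_{\rho Y_1}\\ \vdots\\ h_{\rho Y_{n_c-1}}\\ h_\rho\\ h_\rho\,\overline{\mathbf v}+\frac{\overline{\mathrm p\theta}}{\overline\theta}\mathbf n\\ \displaystyle\sum_{i=1}^{n_c-1}\frac{C_{v_i}-C_{v_{n_c}}}{\widehat\theta}h_{\rho Y_i}+\Big(\frac{C_{v_{n_c}}}{\widehat\theta}+\frac{\mathbf v^-\cdot\mathbf v^+}2\Big)h_\rho+\frac{\overline{\mathrm p\theta}}{\overline\theta}\,\overline{\mathbf v}\cdot\mathbf n\end{pmatrix},$$ with $$h_{\rho Y_i}=\frac{r_{n_c}\big(\widehat{\rho_{n_c}}-\widehat\rho\big)}{r(\overline{\mathbf Y})-r_{n_c}}\,\overline{Y_i}\,\overline{\mathbf v}\cdot\mathbf n\quad(1\le i\le n_c-1),\qquad h_\rho=\widehat\rho\;\overline{\mathbf v}\cdot\mathbf n .$$ Then, for the multicomponent Euler system and the entropy pair $(\eta,\mathbf q)=(-\rho\mathrm s,-\rho\mathrm s\mathbf v)$, $\mathbf h_{ec}$ is - symmetric: $\mathbf h_{ec}(\mathbf u^-,\mathbf u^+,\mathbf n)=\mathbf h_{ec}(\mathbf u^+,\mathbf u^-,\mathbf n)$ for all $\mathbf u^\pm\in\Omega^a$; - consistent: $\mathbf h_{ec}(\mathbf u,\mathbf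 u,\mathbf n)=\mathbf f(\mathbf u)\cdot\mathbf n$ for all $\mathbf u\in\Omega^a$; - entropy conservative: $[\![\boldsymbol\eta'(\mathbf u)]\!]\cdot\mathbf h_{ec}(\mathbf u^-,\mathbf u^+,\mathbf n)=[\![\boldsymbol\psi(\mathbf u)\cdot\mathbf n]\!]$ for all $\mathbf u^\pm\in\Omega^a$.
   Context: **Notation.** $[\![a]\!]=a^+-a^-$, $\overline a=\frac{a^++a^-}2$, and $\widehat a=\frac{[\![a]\!]}{[\![\ln a]\!]}$ is the logarithmic mean of positive $a^\pm$ (with $\widehat a=a$ when $a^+=a^-=a$). $\overline{\mathbf Y}$ is the componentwise average. **Model.** Let $d\ge1$, $n_c\ge2$ components, constants $C_{v_i}>0$, $\gamma_i>1$, $C_{p_i}=\gamma_iC_{v_i}$, $r_i=C_{p_i}-C_{v_i}>0$, $\mathrm s_i^\infty\in\mathbb R$ ($1\le i\le n_c$). The unknown is $\mathbf u=(\rho\mathbf Y^\top,\rho,\rho\mathbf v^\top,\rho E)^\top\in\mathbb R^{n_c+d+1}$ with $\mathbf Y=(Y_1,\dots,Y_{n_c-1})^\top$, $Y_{n_c}=1-\sum_{i<n_c}Y_i$, $\mathbf v\in\mathbb R^d$, $e=E-\frac12\mathbf v\cdot\mathbf v$. Mixture laws: $C_p(\mathbf Y)=\sum_{i=1}^{n_c}Y_iC_{p_i}$, $C_v(\mathbf Y)=\sum_{i=1}^{n_c}Y_iC_{v_i}$, $r(\mathbf Y)=C_p(\mathbf Y)-C_v(\mathbf Y)$, $\gamma(\mathbf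 Y)=C_p(\mathbf Y)/C_v(\mathbf Y)$, temperature $\mathrm T=e/C_v(\mathbf Y)$, $\theta=1/\mathrm T$, pressure $\mathrm p=(\gamma(\mathbf Y)-1)\rho e=\rho r(\mathbf Y)\mathrm T$, partial densities $\rho_i=\rho\,r(\mathbf Y)/r_i$. The system is $\partial_t\mathbf u+\nabla\cdot\mathbf f(\mathbf u)=0$ with $\mathbf f(\mathbf u)\cdot\mathbf n=\big(\rho\mathbf Y^\top\mathbf v\cdot\mathbf n,\ \rho\mathbf v\cdot\mathbf n,\ \rho(\mathbf v\cdot\mathbf n)\mathbf v^\top+\mathrm p\,\mathbf n^\top,\ (\rho E+\mathrm p)\mathbf v\cdot\mathbf n\big)^\top$. Admissible states: $\Omega^a=\{\mathbf u:\ 0\le Y_i\le1\ (1\le i\le n_c),\ \rho>0,\ e>0\}$. **Entropy.** $\mathrm s=\sum_{i=1}^{n_c}Y_i\mathrm s_i$ with $\mathrm s_i=-C_{v_i}\ln\theta-r_i\ln\rho_i+C_{v_i}\ln C_{v_i}+\mathrm s_i^\infty$; $\eta(\mathbf u)=-\rho\mathrm s$, $\mathbf q(\mathbf u)=-\rho\mathrm s\mathbf v$. Entropy variables (gradient of $\eta$ with respect to $\mathbf u$): $\boldsymbol\eta'(\mathbf u)=\big((\mathrm s_{n_c}-\mathrm s_i+C_{p_i}-C_{p_{n_c}})_{1\le i<n_c},\ C_{p_{n_c}}-\mathrm s_{n_c}-\frac{\mathbf v\cdot\mathbf v}2\theta,\ \theta\mathbf v^\top,\ -\theta\big)^\top$.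 Entropy potential: $\boldsymbol\psi(\mathbf u)=\mathbf f(\mathbf u)^\top\boldsymbol\eta'(\mathbf u)-\mathbf q(\mathbf u)=r(\mathbf Y)\rho\mathbf v$.
   Formalization: Consistency and entropy conservation are stated only where the flux is defined: r(Ȳ) ≠ r_{n_c}, or all Ȳ_i = 0 for i < n_c (then h_{ρY_i} = 0). Elsewhere the quotient in h_{ρY_i} divides by zero, e.g. when all r_i are equal. *)

(* Defs.v *)
From HB Require Import structures.
From mathcomp Require Import all_boot all_order all_algebra.
From mathcomp Require Import all_classical all_reals all_analysis.

Set Implicit Arguments.
Unset Strict Implicit.
Unset Printing Implicit Defensive.

Import Order.TTheory GRing.Theory Num.Theory.
Import numFieldNormedType.Exports.

Local Open Scope ring_scope.

Section TwoPoint.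
Context {R : realType}.

Definition dotv (k : nat) (a b : 'cV[R]_k) : R := \sum_(i < k) a i 0 * b i 0.

(* Two-point operators take the "minus" state first. *)
Definition jump (V : zmodType) (am ap : V) : V := ap - am.

Definition avg (am ap : R) : R := (am + ap) / 2.

Definition avgv (k : nat) (am ap : 'cV[R]_k) : 'cV[R]_k :=
  \col_i avg (am i 0) (ap i 0).

Definition logmean (am ap : R) : R :=
  if am == ap then am else jump am ap / jump (ln am) (ln ap).

End TwoPoint.

(* The mixture has n_c = m.+1 components, the last one being [ord_max]. *)
Record mixture (R : realType) (m : nat) := Mixture {
  Cv : 'I_m.+1 -> R;
  gam : 'I_m.+1 -> R;
  sinf : 'I_m.+1 -> R
}.

Section Laws.
Context {R : realType} {m : nat} (G : mixture R m).

Definition Cp (i : 'I_m.+1) : R := gam G i * Cv G i.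

Definition rgas (i : 'I_m.+1) : R := Cp i - Cv G i.

(* Only the first m mass fractions are unknowns; Y_{n_c} is the complement. *)
Definition massfrac (Y : 'cV[R]_m) (i : 'I_m.+1) : R :=
  if unlift ord_max i is Some j then Y j 0 else 1 - \sum_(j < m) Y j 0.

Definition mixCp (Y : 'cV[R]_m) : R := \sum_(i < m.+1) massfrac Y i * Cp i.

Definition mixCv (Y : 'cV[R]_m) : R := \sum_(i < m.+1) massfrac Y i * Cv G i.

Definition mixr (Y : 'cV[R]_m) : R := mixCp Y - mixCv Y.

Definition mixgam (Y : 'cV[R]_m) : R := mixCp Y / mixCv Y.

End Laws.

(* Conserved variables (rho Y, rho, rho v, rho E) in R^(n_c + d + 1). *)
Notation state R m d := 'cV[R]_(m + (1 + (d + 1))).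

Section State.
Context {R : realType} {m d : nat} (G : mixture R m).
Implicit Type u : state R m d.

Definition mkstate (k : nat) (a : 'M[R]_(m, k)) (b : 'M[R]_(1, k))
    (c : 'M[R]_(d, k)) (e : 'M[R]_(1, k)) : 'M[R]_(m + (1 + (d + 1)), k) :=
  col_mx a (col_mx b (col_mx c e)).

Definition rho u : R := (usubmx (dsubmx u)) 0 0.

Definition Yof u : 'cV[R]_m := (rho u)^-1 *: usubmx u.

Definition vel u : 'cV[R]_d := (rho u)^-1 *: usubmx (dsubmx (dsubmx u)).

Definition Etot u : R := (dsubmx (dsubmx (dsubmx u))) 0 0 / rho u.

Definition eint u : R := Etot u - dotv (vel u) (vel u) / 2.

Definition temp u : R := eint u / mixCv G (Yof u).

Definition theta u : R := (temp u)^-1.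

Definition pres u : R := (mixgam G (Yof u) - 1) * rho u * eint u.

Definition rhopart (i : 'I_m.+1) u : R := rho u * mixr G (Yof u) / rgas G i.

Definition admissible u : Prop :=
  [/\ forall i : 'I_m.+1, 0 <= massfrac (Yof u) i <= 1, 0 < rho u & 0 < eint u].

(* f(u); its k-th column is the flux in direction k, and f(u).n is
   [flux u *m n]. *)
Definition flux u : 'M[R]_(m + (1 + (d + 1)), d) :=
  mkstate (rho u *: (Yof u *m (vel u)^T))
          (rho u *: (vel u)^T)
          (rho u *: (vel u *m (vel u)^T) + (pres u)%:M)
          ((rho u * Etot u + pres u) *: (vel u)^T).

Definition spart (i : 'I_m.+1) u : R :=
  - Cv G i * ln (theta u) - rgas G i * ln (rhopart i u)
  + Cv G i * ln (Cv G i) + sinf G i.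

Definition sspec u : R := \sum_(i < m.+1) massfrac (Yof u) i * spart i u.

Definition entropy u : R := - rho u * sspec u.

Definition qflux u : 'cV[R]_d := (- rho u * sspec u) *: vel u.

Definition entropy_var u : state R m d := \col_j 'D_(delta_mx j 0) entropy u.

Definition potential u : 'cV[R]_d := (flux u)^T *m entropy_var u - qflux u.

Section Flux.
Variables (um up : state R m d) (n : 'cV[R]_d).

Let Ybar := avgv (Yof um) (Yof up).
Let vbar := avgv (vel um) (vel up).
Let thetahat := logmean (theta um) (theta up).
Let pstar :=
  avg (pres um * theta um) (pres up * theta up) / avg (theta um) (theta up).

Definition h_rho : R := logmean (rho um) (rho up) * dotv vbar n.

Definition h_rhoY (i : 'I_m) : R :=
  rgas G ord_max
  * (logmean (rhopart ord_max um) (rhopart ord_max up)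
     - logmean (rho um) (rho up))
  / (mixr G Ybar - rgas G ord_max) * Ybar i 0 * dotv vbar n.

(* [lift ord_max i] is the index i < n_c - 1 seen among all n_c components. *)
Definition hec : state R m d :=
  mkstate (\col_i h_rhoY i)
    (h_rho%:M)
    (h_rho *: vbar + pstar *: n)
    ((\sum_(i < m)
        (Cv G (lift ord_max i) - Cv G ord_max) / thetahat * h_rhoY i
      + (Cv G ord_max / thetahat + dotv (vel um) (vel up) / 2) * h_rho
      + pstar * dotv vbar n)%:M).

(* The quotient in [h_rhoY] has denominator
     sum_(i < n_c) (r_i - r_{n_c}) Ybar_i,
   which may vanish; the singularity is not removable in general.  The fluxes
   h_{rho Y_i} make sense when it does not vanish, or when every factor Ybar_i
   vanishes (only component n_c is present on both sides), in which case they
   are 0.  For two components with r_1 <> r_2 this always holds. *)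
Definition hec_defined : Prop :=
  mixr G Ybar != rgas G ord_max \/ forall i : 'I_m, Ybar i 0 = 0.

End Flux.

End State.

(* Main.v *)
Require Import Defs.
From HB Require Import structures.
From mathcomp Require Import all_boot all_order all_algebra.
From mathcomp Require Import all_classical all_reals all_analysis.
From mathcomp Require Import ring lra.

(* Every weighted sum rho * sum_i c_i Y_i is linear in the conserved variables.
   With W, P the sums for c = Cv, r and rho e = rho E - |rho v|^2 / (2 rho),
   the entropy is W ln (W / (rho e)) + P ln P - (a linear form), which gives
   its gradient by one-variable calculus along lines.  In the product of the
   jump of the entropy variables with the flux, the energy component cancels
   the W terms because [[ln theta]] = [[theta]] / thetahat; the choice of
   h_{rho Y_i} makes sum_i r_i h_{rho Y_i} = r_{n_c} rhohat_{n_c} vbar.n, so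
   that the P terms reduce to [[rho r]] vbar.n; and the velocity terms leave
   avg(p theta) [[v.n]].  The product rule for jumps concludes. *)

Set Implicit Arguments.
Unset Strict Implicit.
Unset Printing Implicit Defensive.

Import Order.TTheory GRing.Theory Num.Theory.
Import numFieldNormedType.Exports.

Local Open Scope ring_scope.

(** * Bilinear algebra of the dot product *)

Section DotProduct.
Context {R : realType}.

Lemma dotvC k (a b : 'cV[R]_k) : dotv a b = dotv b a.
Proof. by apply: eq_bigr => i _; rewrite mulrC. Qed.

Lemma dotvDl k (a b c : 'cV[R]_k) : dotv (a + b) c = dotv a c + dotv b c.
Proof. by rewrite /dotv -big_split; apply: eq_bigr => i _; rewrite mxE mulrDl. Qed.

Lemma dotvZl k x (a c : 'cV[R]_k) : dotv (x *: a) c = x * dotv a c.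
Proof. by rewrite /dotv mulr_sumr; apply: eq_bigr => i _; rewrite mxE mulrA. Qed.

Lemma dotvBl k (a b c : 'cV[R]_k) : dotv (a - b) c = dotv a c - dotv b c.
Proof. by rewrite -scaleN1r dotvDl dotvZl mulN1r. Qed.

Lemma dotvDr k (a b c : 'cV[R]_k) : dotv c (a + b) = dotv c a + dotv c b.
Proof. by rewrite !(dotvC c) dotvDl. Qed.

Lemma dotvZr k x (a c : 'cV[R]_k) : dotv c (x *: a) = x * dotv c a.
Proof. by rewrite !(dotvC c) dotvZl. Qed.

Lemma dotv_delta k (a : 'cV[R]_k) j : dotv a (delta_mx j 0) = a j 0.
Proof.
rewrite /dotv (bigD1 j) //= big1 => [|i ij]; rewrite mxE !eqxx ?mulr1 ?addr0 //.
by rewrite (negbTE ij) mulr0.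
Qed.

Lemma dotv_col_mx k l (a a' : 'cV[R]_k) (b b' : 'cV[R]_l) :
  dotv (col_mx a b) (col_mx a' b') = dotv a a' + dotv b b'.
Proof.
rewrite /dotv big_split_ord; congr (_ + _); apply: eq_bigr => i _.
  by rewrite !col_mxEu.
by rewrite !col_mxEd.
Qed.

Lemma dotv1 (a b : 'cV[R]_1) : dotv a b = a 0 0 * b 0 0.
Proof. by rewrite /dotv big_ord1. Qed.

Lemma avgvE k (a b : 'cV[R]_k) : avgv a b = 2^-1 *: (a + b).
Proof. by apply/colP => i; rewrite !mxE mulrC. Qed.

Lemma dotv_avgv k (a b c : 'cV[R]_k) : dotv (avgv a b) c = avg (dotv a c) (dotv b c).
Proof. by rewrite avgvE dotvZl dotvDl mulrC. Qed.

Lemma trmulmx_dotv k (a b : 'cV[R]_k) : a^T *m b = (dotv a b)%:M.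
Proof.
rewrite [LHS]mx11_scalar mxE; congr _%:M.
by apply: eq_bigr => i _; rewrite mxE.
Qed.

(** Adjointness moves the normal [n] from the potential onto the flux, so that the potential can be
    computed from [flux u *m n]. *)
Lemma dotv_mulmx k l (A : 'M[R]_(k, l)) (a : 'cV[R]_k) (b : 'cV[R]_l) :
  dotv (A^T *m a) b = dotv a (A *m b).
Proof.
have dotvE j (x y : 'cV[R]_j) : dotv x y = (x^T *m y) 0 0.
  by rewrite trmulmx_dotv mxE.
by rewrite !dotvE trmx_mul trmxK mulmxA.
Qed.

End DotProduct.

(** * Arithmetic and logarithmic means *)

Section TwoPointMeans.
Context {R : realType}.

Lemma avgC (a b : R) : avg a b = avg b a.
Proof. by rewrite /avg addrC. Qed.

Lemma avgxx (a : R) : avg a a = a.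
Proof. by rewrite /avg; field. Qed.

Lemma avgvC k (a b : 'cV[R]_k) : avgv a b = avgv b a.
Proof. by rewrite !avgvE addrC. Qed.

Lemma avgvxx k (a : 'cV[R]_k) : avgv a a = a.
Proof. by apply/colP => i; rewrite mxE avgxx. Qed.

Lemma logmeanC (a b : R) : logmean a b = logmean b a.
Proof.
rewrite /logmean /jump eq_sym; case: eqP => [->//|_].
by rewrite -(opprB b a) -(opprB (ln b)) invrN mulrNN.
Qed.

Lemma logmeanxx (a : R) : logmean a a = a.
Proof. by rewrite /logmean eqxx. Qed.

(** The product form also covers equal arguments, where both sides vanish. Otherwise positivity
    makes [ln] injective, so the denominator of the mean is nonzero. *)
Lemma logmean_jump (a b : R) : 0 < a -> 0 < b ->
  logmean a b * (ln b - ln a) = b - a.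
Proof.
move=> a0 b0; rewrite /logmean /jump; case: eqP => [->|/eqP ab].
  by rewrite !subrr mulr0.
rewrite mulfVK // subr_eq0; apply: contra ab => /eqP lnab.
by apply/eqP/ln_inj; rewrite ?posrE.
Qed.

Lemma logmean_neq0 (a b : R) : 0 < a -> 0 < b -> logmean a b != 0.
Proof.
move=> a0 b0; have := logmean_jump a0 b0; rewrite /logmean.
case: eqP => [_ _|/eqP ab]; first by rewrite gt_eqF.
move=> H; apply: contra ab => /eqP E0; move: H; rewrite E0 mul0r => /esym/eqP.
by rewrite subr_eq0 eq_sym.
Qed.

End TwoPointMeans.

(** * Sums weighted by mass fractions *)

Section Fractions.
Context {R : realType} {m : nat}.

Lemma sum_massfrac (Y : 'cV[R]_m) (c : 'I_m.+1 -> R) :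
  \sum_i massfrac Y i * c i =
  c ord_max + \sum_(j < m) (c (lift ord_max j) - c ord_max) * Y j 0.
Proof.
rewrite (bigD1_ord ord_max) //= {1}/massfrac unlift_none.
under eq_bigr => j _ do rewrite /massfrac liftK.
under [in RHS]eq_bigr => j _ do rewrite mulrBl (mulrC (c _)).
by rewrite sumrB -mulr_sumr; ring.
Qed.

Lemma massfrac1 (Y : 'cV[R]_m) : \sum_i massfrac Y i = 1.
Proof.
have := sum_massfrac Y (fun=> 1); under eq_bigr do rewrite mulr1.
by move=> ->; rewrite big1 ?addr0 // => j _; rewrite subrr mul0r.
Qed.

(** Strictness holds because a vanishing sum would force every mass fraction to vanish, whereas they
    add up to 1. *)
Lemma sum_massfrac_gt0 (Y : 'cV[R]_m) (c : 'I_m.+1 -> R) :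
  (forall i, 0 <= massfrac Y i) -> (forall i, 0 < c i) ->
  0 < \sum_i massfrac Y i * c i.
Proof.
move=> Y0 c0; have S0 : 0 <= \sum_i massfrac Y i * c i.
  by apply: sumr_ge0 => i _; rewrite mulr_ge0 // ltW.
rewrite lt_neqAle S0 andbT; apply/negP => /eqP/esym/eqP.
rewrite psumr_eq0 => [/allP Z|i _]; last by rewrite mulr_ge0 // ltW.
have /eqP := massfrac1 Y; rewrite big1 ?(eq_sym 0) ?oner_eq0 // => i _.
by apply/eqP; have := Z i (mem_index_enum _); rewrite mulf_eq0 (gt_eqF (c0 i)) orbF.
Qed.

End Fractions.

(** * Linear functionals of the conserved variables *)

Section Extensive.
Context {R : realType} {m d : nat}.
Implicit Types u v : state R m d.

Definition momentum u : 'cV[R]_d := usubmx (dsubmx (dsubmx u)).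

Definition energy u : R := (dsubmx (dsubmx (dsubmx u))) 0 0.

(* Equals rho * sum_i c_i Y_i when rho <> 0, but is linear in u everywhere. *)
Definition extensive (c : 'I_m.+1 -> R) u : R :=
  rho u * c ord_max +
  \sum_(j < m) (c (lift ord_max j) - c ord_max) * usubmx u j 0.

(** The order [t *: v + u] is the one produced by [shift u] in the directional derivative. *)
Lemma rho_line u v (t : R) : rho (t *: v + u) = t * rho v + rho u.
Proof. by rewrite /rho !mxE. Qed.

Lemma energy_line u v (t : R) : energy (t *: v + u) = t * energy v + energy u.
Proof. by rewrite /energy !mxE. Qed.

Lemma momentum_line u v (t : R) :
  momentum (t *: v + u) = t *: momentum v + momentum u.
Proof. by apply/colP => i; rewrite !mxE. Qed.

Lemma extensive_line c u v (t : R) :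
  extensive c (t *: v + u) = t * extensive c v + extensive c u.
Proof.
rewrite /extensive rho_line mulrDr mulr_sumr mulrDl addrACA mulrA; congr (_ + _).
by rewrite -big_split; apply: eq_bigr => j _ /=; rewrite !mxE; ring.
Qed.

Lemma extensive_lin u (x y : R) (c c' : 'I_m.+1 -> R) :
  extensive (fun i => x * c i + y * c' i) u = x * extensive c u + y * extensive c' u.
Proof.
rewrite /extensive !mulrDr !mulr_sumr addrACA -big_split; congr (_ + _).
  by ring.
by apply: eq_bigr => j _ /=; ring.
Qed.

Lemma extensiveE c u : rho u != 0 ->
  extensive c u = rho u * \sum_i massfrac (Yof u) i * c i.
Proof.
move=> r0; rewrite sum_massfrac mulrDr mulr_sumr; congr (_ + _).
by apply: eq_bigr => j _; rewrite !mxE mulrCA mulVKf.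
Qed.

Lemma momentumE u : rho u != 0 -> momentum u = rho u *: vel u.
Proof. by move=> r0; rewrite scalerA divff // scale1r. Qed.

Lemma energyE u : rho u != 0 -> energy u = rho u * Etot u.
Proof. by move=> r0; rewrite mulrC divfK. Qed.

Lemma rho_mkstate a b c e : rho (mkstate a b c e : state R m d) = b 0 0.
Proof. by rewrite /rho /mkstate col_mxKd col_mxKu. Qed.

Lemma energy_mkstate a b c e : energy (mkstate a b c e : state R m d) = e 0 0.
Proof. by rewrite /energy /mkstate !col_mxKd. Qed.

Lemma momentum_mkstate a b c e : momentum (mkstate a b c e : state R m d) = c.
Proof. by rewrite /momentum /mkstate !col_mxKd col_mxKu. Qed.

Lemma extensive_mkstate f a b c e :
  extensive f (mkstate a b c e : state R m d) =
  b 0 0 * f ord_max + \sum_(j < m) (f (lift ord_max j) - f ord_max) * a j 0.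
Proof. by rewrite /extensive rho_mkstate /mkstate col_mxKu. Qed.

Lemma mkstateE u :
  u = mkstate (usubmx u) (rho u)%:M (momentum u) (energy u)%:M.
Proof. by rewrite /mkstate /rho /momentum /energy -!mx11_scalar !vsubmxK. Qed.

Lemma dotv_mkstate a b c e u : dotv (mkstate a b c e : state R m d) u =
  dotv a (usubmx u) + b 0 0 * rho u + dotv c (momentum u) + e 0 0 * energy u.
Proof.
by rewrite {1}(mkstateE u) /mkstate !dotv_col_mx !dotv1 !mxE mulr1n !addrA.
Qed.

End Extensive.

(** * The gradient of the entropy *)

Section EntropyGradient.
Context {R : realType} {m d : nat} (G : mixture R m).
Hypothesis hCv : forall i, 0 < Cv G i.
Hypothesis hgam : forall i, 1 < gam G i.
Implicit Types u v : state R m d.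

Lemma rgas_gt0 i : 0 < rgas G i.
Proof. by rewrite /rgas /Cp -{2}(mul1r (Cv G i)) -mulrBl mulr_gt0 // subr_gt0. Qed.

Lemma mixrE (Y : 'cV[R]_m) : mixr G Y = \sum_i massfrac Y i * rgas G i.
Proof.
by rewrite /mixr /mixCp /mixCv -sumrB; apply: eq_bigr => i _; rewrite mulrBr.
Qed.

Lemma extensive_rgas u : rho u != 0 ->
  extensive (rgas G) u = rho u * mixr G (Yof u).
Proof. by move=> r0; rewrite extensiveE // mixrE. Qed.

Lemma extensive_Cv u : rho u != 0 ->
  extensive (Cv G) u = rho u * mixCv G (Yof u).
Proof. exact: extensiveE. Qed.

(** The density rho e in conserved variables; along a line it is an explicit rational function of
    the parameter. *)
Definition internal u : R :=
  energy u - dotv (momentum u) (momentum u) / (2 * rho u).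

Lemma internalE u : rho u != 0 -> internal u = rho u * eint u.
Proof.
move=> r0; rewrite /internal energyE // !momentumE // dotvZl dotvZr /eint.
by field.
Qed.

Lemma thetaE u : rho u != 0 -> theta G u = extensive (Cv G) u / internal u.
Proof.
move=> r0; rewrite /theta /temp invf_div extensive_Cv // internalE //.
by rewrite -mulf_div divff // mul1r.
Qed.

Lemma spartE i u : rho u != 0 -> 0 < extensive (rgas G) u ->
  spart G i u = - Cv G i * ln (theta G u)
    - rgas G i * (ln (extensive (rgas G) u) - ln (rgas G i))
    + Cv G i * ln (Cv G i) + sinf G i.
Proof.
move=> r0 P0; rewrite /spart /rhopart -extensive_rgas //.
by rewrite ln_div ?posrE ?rgas_gt0.
Qed.

(** The part of s_i that does not depend on the state, once ln rho_i is split as ln (rho r) - ln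
    r_i. *)
Definition sconst (i : 'I_m.+1) : R :=
  rgas G i * ln (rgas G i) + Cv G i * ln (Cv G i) + sinf G i.

(** The s_i are frozen at [u] while the weights come from an independent [v]. Taking [v] to be [u],
    a direction or the numerical flux serves the entropy, its gradient and the conservation identity
    respectively. *)
Lemma extensive_spart u v : rho u != 0 -> 0 < extensive (rgas G) u ->
  extensive (fun i => spart G i u) v =
  - (extensive (Cv G) v * ln (theta G u)
     + extensive (rgas G) v * ln (extensive (rgas G) u)
     - extensive sconst v).
Proof.
move=> r0 P0.
have -> : (fun i => spart G i u) =
    (fun i => - ln (theta G u) * Cv G i
      + 1 * (- ln (extensive (rgas G) u) * rgas G i + 1 * sconst i)).
  by apply/funext => i; rewrite spartE // /sconst; ring.
by rewrite !extensive_lin; ring.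
Qed.

(** The hypotheses are open conditions rather than admissibility: a state with some Y_i = 0 has
    neighbours outside the admissible set, and the formula must hold at them to be
    differentiated. *)
Lemma entropyE u : rho u != 0 -> 0 < extensive (rgas G) u ->
  entropy G u =
  extensive (Cv G) u * ln (extensive (Cv G) u / internal u)
  + extensive (rgas G) u * ln (extensive (rgas G) u)
  - extensive sconst u.
Proof.
move=> r0 P0; rewrite /entropy /sspec mulNr -extensiveE // extensive_spart //.
by rewrite opprK thetaE.
Qed.

Definition entropy_grad u : state R m d :=
  mkstate
    (\col_j (spart G ord_max u - spart G (lift ord_max j) u
             + Cp G (lift ord_max j) - Cp G ord_max))
    (Cp G ord_max - spart G ord_max u - dotv (vel u) (vel u) / 2 * theta G u)%:M
    (theta G u *: vel u)
    (- theta G u)%:M.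

(** The mass blocks combine into a single functional with weights Cp_i - s_i. The bracket
    multiplying theta is the derivative of [internal] at [u] in the direction [v]. *)
Lemma dotv_entropy_grad u v : dotv (entropy_grad u) v =
  extensive (Cp G) v - extensive (fun i => spart G i u) v
  - theta G u * (energy v - dotv (vel u) (momentum v)
                 + dotv (vel u) (vel u) / 2 * rho v).
Proof.
have -> : extensive (Cp G) v - extensive (fun i => spart G i u) v =
    extensive (fun i => 1 * Cp G i + -1 * spart G i u) v.
  by rewrite extensive_lin; ring.
rewrite dotv_mkstate /extensive dotvZl !mxE /= !mulr1n.
rewrite [dotv (\col__ _) _](_ : _ = \sum_(j < m)
  (1 * Cp G (lift ord_max j) + -1 * spart G (lift ord_max j) u
   - (1 * Cp G ord_max + -1 * spart G ord_max u)) * usubmx v j 0); last first.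
  by apply: eq_bigr => j _; rewrite mxE; ring.
by ring.
Qed.

Lemma admissible_gt0 u : admissible u ->
  [/\ 0 < rho u, 0 < mixr G (Yof u), 0 < mixCv G (Yof u) & 0 < theta G u].
Proof.
case=> Y01 r0 e0; have Y0 i : 0 <= massfrac (Yof u) i by case/andP: (Y01 i).
have Cv0 : 0 < mixCv G (Yof u) by apply: sum_massfrac_gt0.
split=> //; last by rewrite invr_gt0 divr_gt0.
by rewrite mixrE; apply: sum_massfrac_gt0 => // i; apply: rgas_gt0.
Qed.

(** Both derivatives are limits of the same difference quotient, which reduces the entropy gradient
    to calculus in one real variable. *)
Lemma is_derive_line (f : state R m d -> R) u v (df : R) :
  is_derive (0 : R) 1 (fun t : R => f (t *: v + u)) df -> is_derive u v f df.
Proof.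
have E : (fun h : R => h^-1 *: ((f \o shift u) (h *: v) - f u)) =
   (fun h : R => h^-1 *: (((fun t : R => f (t *: v + u)) \o shift 0) (h *: 1)
       - f (0 *: v + u))).
  by apply/funext => h /=; rewrite scale0r add0r addr0 scaler1.
by case=> dg vg; split; [rewrite /derivable E | rewrite -vg /derive E].
Qed.

Lemma is_derive_affine (a b x : R) : is_derive x 1 (fun t : R => t * a + b) a.
Proof.
have -> : (fun t : R => t * a + b) = (id * cst a + cst b) by [].
apply: is_derive_eq; rewrite /= addr0 scaler0 add0r.
by rewrite -[_ *: _]/(a * 1) mulr1.
Qed.

Lemma near_affine_gt0 (a b : R) : 0 < b -> \forall t \near (0 : R), 0 < t * a + b.
Proof.
move=> b0; have c : {for (0 : R), continuous (fun t : R => t * a + b)}.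
  by apply/differentiable_continuous/derivable1_diffP; case: (is_derive_affine a b 0).
by have := cvgr_gt _ c 0; rewrite mul0r add0r; apply.
Qed.

Lemma is_derive_mulln (w g : R -> R) (x dw dg : R) : 0 < g x ->
  is_derive x 1 w dw -> is_derive x 1 g dg ->
  is_derive x 1 (fun t => w t * ln (g t)) (dw * ln (g x) + w x * (dg / g x)).
Proof.
move=> g0 hw hg.
have hl : is_derive x 1 (@ln R \o g) ((g x)^-1 * dg).
  exact: is_derive1_comp (is_derive1_ln g0) hg.
apply: (is_derive_eq (is_deriveM hw hl)) => /=.
by rewrite -![_ *: _]/(_ * _) addrC (mulrC dw) (mulrC dg).
Qed.

Lemma is_derive_div (w g : R -> R) (x dw dg : R) : g x != 0 ->
  is_derive x 1 w dw -> is_derive x 1 g dg ->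
  is_derive x 1 (fun t => w t / g t) (dw / g x - w x * dg / g x ^+ 2).
Proof.
move=> g0 hw hg; have hv := is_deriveV g0 hg.
apply: (is_derive_eq (is_deriveM hw hv)) => /=.
by rewrite -![_ *: _]/(_ * _); field.
Qed.

Lemma is_derive_internal u v : rho u != 0 ->
  is_derive (0 : R) 1 (fun t : R => internal (t *: v + u))
    (energy v - dotv (vel u) (momentum v) + dotv (vel u) (vel u) / 2 * rho v).
Proof.
move=> r0; set mu := momentum u; set mv := momentum v.
have -> : dotv (vel u) mv = dotv mu mv / rho u.
  by rewrite /mu momentumE // dotvZl mulrC mulKf.
have -> : dotv (vel u) (vel u) = dotv mu mu / rho u ^+ 2.
  by rewrite /mu momentumE // dotvZl dotvZr; field.
set B := dotv mu mv; set C := dotv mv mv; set A := dotv mu mu.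
(* [N t] is half the squared norm of [t *: mv + mu], factored into affine functions; the [+ 0] gives
   the second factor the shape of [is_derive_affine]. *)
pose N (t : R) : R := (t * C + 2 * B) * (t * 2^-1 + 0) + A * 2^-1.
have hN : is_derive (0 : R) 1 N B.
  apply: (is_derive_eq (is_deriveD (is_deriveM (is_derive_affine C (2 * B) 0)
    (is_derive_affine 2^-1 0 0)) (is_derive_cst (A * 2^-1 : R) (0 : R) (1 : R)))).
  by rewrite -![_ *: _]/(_ * _); field.
have hD := is_derive_div _ hN (is_derive_affine (rho v) (rho u) 0).
rewrite mul0r add0r in hD.
have hF := is_deriveD (is_derive_affine (energy v) (energy u) 0) (is_deriveN (hD r0)).
have -> : (fun t : R => internal (t *: v + u)) =
    (fun t => (t * energy v + energy u) - N t / (t * rho v + rho u)).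
  apply/funext => t; rewrite /internal energy_line rho_line momentum_line -/mu -/mv.
  rewrite !(dotvDl, dotvDr, dotvZl, dotvZr) (dotvC mv mu) -/A -/B -/C invfM.
  by congr (_ + _); rewrite mulrA; congr (- (_ / _)); rewrite /N; field.
apply: (is_derive_eq hF).
by rewrite /N; field.
Qed.

Lemma is_derive_entropy u v : admissible u ->
  is_derive u v (entropy G) (dotv (entropy_grad u) v).
Proof.
move=> adm; have [r0 mr0 mCv0 th0] := admissible_gt0 adm.
have rn0 : rho u != 0 by rewrite gt_eqF.
have P0 : 0 < extensive (rgas G) u by rewrite extensive_rgas // mulr_gt0.
have W0 : 0 < extensive (Cv G) u by rewrite extensive_Cv // mulr_gt0.
have e0 : 0 < internal u by case: adm => _ _ e0; rewrite internalE // mulr_gt0.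
apply: is_derive_line; set W := @extensive R m d (Cv G); set P := @extensive R m d (rgas G).
(* The closed form of the entropy is valid only where rho and rho r are positive, which holds for
   [t] near 0. *)
apply: (@near_eq_is_derive _ _ _ (fun t : R =>
  (t * W v + W u) * ln ((t * W v + W u) / internal (t *: v + u))
  + (t * P v + P u) * ln (t * P v + P u)
  - (t * extensive sconst v + extensive sconst u))).
  near=> t.
  have rt : 0 < t * rho v + rho u by near: t; exact: near_affine_gt0.
  have Pt : 0 < t * P v + P u by near: t; exact: near_affine_gt0.
  by rewrite entropyE ?extensive_line // rho_line gt_eqF.
have hW := is_derive_affine (W v) (W u) 0.
have hP := is_derive_affine (P v) (P u) 0.
have hI := is_derive_internal v rn0.
have hWI := is_derive_div _ hW hI.
rewrite /= scale0r add0r mul0r add0r in hWI.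
have hL1 := is_derive_mulln _ hW (hWI _).
have hL2 := is_derive_mulln _ hP hP.
rewrite /= scale0r add0r !mul0r !add0r in hL1 hL2.
have h := is_deriveB (is_deriveD (hL1 _ _) (hL2 P0))
  (is_derive_affine (extensive sconst v) (extensive sconst u) 0).
apply: (is_derive_eq (h _ _)).
- by rewrite divr_gt0.
- by rewrite gt_eqF.
rewrite dotv_entropy_grad extensive_spart // thetaE // -/W -/P.
(* Differentiating inside the two logarithms leaves the terms [W v] and [P v], which add up to the
   Cp term since Cp = Cv + r. *)
have -> : extensive (Cp G) v = W v + P v.
  rewrite -[W v]mul1r -[P v]mul1r -extensive_lin; congr extensive.
  by apply/funext => i; rewrite /rgas; ring.
by field; rewrite !gt_eqF.
Unshelve. all: by end_near.
Qed.

Lemma entropy_varE u : admissible u -> entropy_var G u = entropy_grad u.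
Proof.
move=> adm; apply/colP => j; rewrite mxE -dotv_delta.
by have [] := is_derive_entropy (delta_mx j 0) adm.
Qed.

End EntropyGradient.

(** * The exact normal flux and potential, then the three properties of the numerical flux *)

Section NumericalFlux.
Context {R : realType} {m d : nat} (G : mixture R m).
Hypothesis hCv : forall i, 0 < Cv G i.
Hypothesis hgam : forall i, 1 < gam G i.
Implicit Types (u um up : state R m d) (n : 'cV[R]_d).

Lemma mixCvE (Y : 'cV[R]_m) : mixCv G Y =
  Cv G ord_max + \sum_(j < m) (Cv G (lift ord_max j) - Cv G ord_max) * Y j 0.
Proof. exact: sum_massfrac. Qed.

Lemma mixr_subE (Y : 'cV[R]_m) : mixr G Y - rgas G ord_max =
  \sum_(j < m) (rgas G (lift ord_max j) - rgas G ord_max) * Y j 0.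
Proof. by rewrite mixrE sum_massfrac addrC addKr. Qed.

Lemma theta_eint u : admissible u -> theta G u * eint u = mixCv G (Yof u).
Proof. by case=> _ _ e0; rewrite /theta /temp invf_div divfK // gt_eqF. Qed.

Lemma pres_theta u : admissible u -> pres G u * theta G u = rho u * mixr G (Yof u).
Proof.
move=> adm; have [_ _ Cv0 _] := admissible_gt0 hCv hgam adm.
rewrite /pres -mulrA (mulrC _ (theta G u)) theta_eint // /mixgam /mixr.
by field; rewrite gt_eqF.
Qed.

Lemma flux_mulmx u n : flux G u *m n =
  mkstate ((rho u * dotv (vel u) n) *: Yof u)
    (rho u * dotv (vel u) n)%:M
    ((rho u * dotv (vel u) n) *: vel u + pres G u *: n)
    ((rho u * Etot u + pres G u) * dotv (vel u) n)%:M.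
Proof.
rewrite /flux /mkstate !mul_col_mx mulmxDl -!scalemxAl -!mulmxA trmulmx_dotv.
by rewrite !mul_mx_scalar mul_scalar_mx !scalerA !scale_scalar_mx (mulrAC (rho u)).
Qed.

(** All mass densities are advected with the same speed v.n, hence so is each of their linear
    combinations. *)
Lemma extensive_flux (c : 'I_m.+1 -> R) u n : rho u != 0 ->
  extensive c (flux G u *m n) = dotv (vel u) n * extensive c u.
Proof.
move=> r0; rewrite (extensiveE _ r0) flux_mulmx extensive_mkstate sum_massfrac.
rewrite mxE eqxx mulr1n; under eq_bigr => j _ do rewrite mxE mulrCA.
by rewrite -mulr_sumr; ring.
Qed.

Lemma dotv_potential u n : admissible u ->
  dotv (potential G u) n = rho u * mixr G (Yof u) * dotv (vel u) n.
Proof.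
move=> adm; have [r0 _ _ _] := admissible_gt0 hCv hgam adm.
have rn0 : rho u != 0 by rewrite gt_eqF.
rewrite /potential dotvBl dotv_mulmx entropy_varE // dotv_entropy_grad.
rewrite !extensive_flux // /qflux (dotvZl _ (vel u)) /sspec mulNr -extensiveE //.
rewrite extensiveE // flux_mulmx rho_mkstate momentum_mkstate energy_mkstate.
rewrite !mxE /= !mulr1n dotvDr (dotvZr _ (vel u)) (dotvZr _ n) -/(mixCp G (Yof u)).
(* The s_i terms cancel against the entropy flux, and the pressure terms of momentum and energy
   cancel each other. *)
transitivity (dotv (vel u) n * rho u * (mixCp G (Yof u) - theta G u * eint u)).
  by rewrite /eint; field.
by rewrite theta_eint // /mixr; ring.
Qed.

Lemma hecC um up n : hec G um up n = hec G up um n.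
Proof.
rewrite /hec /h_rhoY /h_rho (avgvC (Yof um)) (avgvC (vel um)).
rewrite (logmeanC (theta G um)) (logmeanC (rho um)).
rewrite (logmeanC (rhopart G ord_max um)) (avgC (pres G um * _)).
by rewrite (avgC (theta G um)) (dotvC (vel um) (vel up)).
Qed.

(** At equal states r_{n_c} (rho_{n_c} - rho) = rho (r - r_{n_c}), so the quotient reduces to rho.
    In the degenerate case both sides are 0. *)
Lemma h_rhoYxx u n i : admissible u -> hec_defined G u u ->
  h_rhoY G u u n i = rho u * Yof u i 0 * dotv (vel u) n.
Proof.
move=> adm; rewrite /hec_defined /h_rhoY !avgvxx !logmeanxx => -[D0|->]; last first.
  by rewrite !(mulr0, mul0r).
by rewrite /rhopart; field; rewrite subr_eq0 D0 gt_eqF // rgas_gt0.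
Qed.

Lemma hec_consistent u n : admissible u -> hec_defined G u u ->
  hec G u u n = flux G u *m n.
Proof.
move=> adm def; have [r0 mr0 Cv0 th0] := admissible_gt0 hCv hgam adm.
rewrite flux_mulmx /hec /h_rho !avgvxx !avgxx !logmeanxx.
rewrite mulfK; last by rewrite gt_eqF.
rewrite /mkstate; congr (col_mx _ (col_mx _ (col_mx _ _%:M))).
  by apply/colP => i; rewrite mxE h_rhoYxx // [RHS]mxE; ring.
(* Adding the C_{v,n_c} term then gives rho (v.n) Cv(Y) / theta, which is rho e (v.n). *)
have -> : \sum_(i < m) (Cv G (lift ord_max i) - Cv G ord_max) / theta G u
    * h_rhoY G u u n i =
    rho u * dotv (vel u) n / theta G u * (mixCv G (Yof u) - Cv G ord_max).
  rewrite mixCvE addrAC subrr add0r mulr_sumr.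
  by apply: eq_bigr => i _; rewrite h_rhoYxx //; ring.
rewrite -theta_eint // /eint; field; by rewrite gt_eqF.
Qed.

(* Nonnegative mass fractions with zero average vanish: only the last component
   is present. *)
Lemma mixr_of_avg0 um up : (forall j, avgv (Yof um) (Yof up) j 0 = 0) ->
  admissible um -> admissible up -> mixr G (Yof um) = rgas G ord_max.
Proof.
move=> Y0 [Y1 _ _] [Y2 _ _]; apply/eqP; rewrite -subr_eq0 mixr_subE.
rewrite big1 // => j _; have := Y0 j; rewrite mxE /avg => Yj.
have := Y1 (lift ord_max j); have := Y2 (lift ord_max j).
rewrite /massfrac liftK => /andP[a _] /andP[b _].
have -> : Yof um j 0 = 0 by lra.
by rewrite mulr0.
Qed.

(** The weights r_i - r_{n_c} applied to Ybar reproduce the denominator of [h_rhoY]; after this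
    cancellation the two contributions of the mean of rho cancel as well. *)
Lemma extensive_rgas_hec um up n : admissible um -> admissible up ->
  hec_defined G um up ->
  extensive (rgas G) (hec G um up n) =
  rgas G ord_max * logmean (rhopart G ord_max um) (rhopart G ord_max up)
  * dotv (avgv (vel um) (vel up)) n.
Proof.
move=> am ap def; have r0 := rgas_gt0 hCv hgam ord_max.
rewrite /hec extensive_mkstate !mxE /= mulr1n /h_rho.
set vn := dotv _ n; under eq_bigr => j _ do rewrite mxE /h_rhoY -/vn.
case: def => [D0|Y0].
  set D := _ - rgas G ord_max; set lr := logmean (rho _) _; set L := logmean _ _.
  have E : \sum_(j < m) (rgas G (lift ord_max j) - rgas G ord_max) *
      avgv (Yof um) (Yof up) j 0 = D by rewrite -mixr_subE.
  rewrite [X in _ + X](_ : _ = rgas G ord_max * (L - lr) / D * vn * D); last first.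
    by rewrite -[X in _ = _ * X]E mulr_sumr; apply: eq_bigr => j _; ring.
  by field; rewrite /D subr_eq0.
(* In the degenerate case the component fluxes vanish and r = r_{n_c} on both sides, so rho_{n_c}
   coincides with rho. *)
rewrite big1 ?addr0 => [|j _]; last by rewrite Y0 !(mulr0, mul0r).
have Y0' j : avgv (Yof up) (Yof um) j 0 = 0 by rewrite avgvC.
by rewrite /rhopart (mixr_of_avg0 Y0) // (mixr_of_avg0 Y0') // !mulfK ?gt_eqF //; ring.
Qed.

(** The logarithms of rho r and of rho_{n_c} differ by the constant ln r_{n_c}, so their jumps agree
    and the logarithmic mean of rho_{n_c} absorbs the jump. *)
Lemma extensive_rgas_jump um up n : admissible um -> admissible up ->
  hec_defined G um up ->
  extensive (rgas G) (hec G um up n)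
  * (ln (extensive (rgas G) up) - ln (extensive (rgas G) um)) =
  (rho up * mixr G (Yof up) - rho um * mixr G (Yof um))
  * dotv (avgv (vel um) (vel up)) n.
Proof.
move=> am ap def; rewrite extensive_rgas_hec //.
have r0 := rgas_gt0 hCv hgam ord_max.
have [rm0 mm0 _ _] := admissible_gt0 hCv hgam am.
have [rp0 mp0 _ _] := admissible_gt0 hCv hgam ap.
rewrite !extensive_rgas ?gt_eqF //.
have part u : 0 < rho u -> 0 < mixr G (Yof u) ->
  0 < rhopart G ord_max u /\
  ln (rho u * mixr G (Yof u)) = ln (rhopart G ord_max u) + ln (rgas G ord_max).
  move=> ru mu; have p0 : 0 < rhopart G ord_max u by rewrite divr_gt0 ?mulr_gt0.
  by rewrite -lnM ?posrE // /rhopart divfK ?gt_eqF.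
have [pm0 ->] := part _ rm0 mm0; have [pp0 ->] := part _ rp0 mp0.
have J := logmean_jump pm0 pp0.
transitivity (rgas G ord_max * (rhopart G ord_max up - rhopart G ord_max um)
  * dotv (avgv (vel um) (vel up)) n); first by rewrite -J; ring.
by rewrite /rhopart; field; rewrite gt_eqF.
Qed.

Lemma rho_hec um up n : rho (hec G um up n) = h_rho um up n.
Proof. by rewrite rho_mkstate mxE eqxx mulr1n. Qed.

Lemma momentum_hec um up n : momentum (hec G um up n) =
  h_rho um up n *: avgv (vel um) (vel up)
  + (avg (pres G um * theta G um) (pres G up * theta G up)
     / avg (theta G um) (theta G up)) *: n.
Proof. exact: momentum_mkstate. Qed.

(** Grouping the component terms into one Cv functional of the flux itself lets them meet the ln
    theta terms, which carry the same functional. *)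
Lemma energy_hec um up n : energy (hec G um up n) =
  extensive (Cv G) (hec G um up n) / logmean (theta G um) (theta G up)
  + dotv (vel um) (vel up) / 2 * h_rho um up n
  + avg (pres G um * theta G um) (pres G up * theta G up)
    / avg (theta G um) (theta G up) * dotv (avgv (vel um) (vel up)) n.
Proof.
rewrite /hec energy_mkstate extensive_mkstate !mxE /= !mulr1n; set t := logmean _ _.
set S := (X in (_ + X) / t); rewrite [X in X + _ + _ = _](_ : _ = S / t).
  by ring.
by rewrite /S mulr_suml; apply: eq_bigr => j _; rewrite mxE mulrAC.
Qed.

Lemma hec_conservative um up n : admissible um -> admissible up ->
  hec_defined G um up ->
  dotv (jump (entropy_var G um) (entropy_var G up)) (hec G um up n) =
  dotv (jump (potential G um) (potential G up)) n.
Proof.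
move=> am ap def.
have [rm0 mm0 _ tm0] := admissible_gt0 hCv hgam am.
have [rp0 mp0 _ tp0] := admissible_gt0 hCv hgam ap.
rewrite /jump (dotvBl (entropy_var G up)) (dotvBl (potential G up)) !dotv_potential // !entropy_varE // !dotv_entropy_grad.
have [nm np] : rho um != 0 /\ rho up != 0 by rewrite !gt_eqF.
have Pm : 0 < extensive (rgas G) um by rewrite extensive_rgas // mulr_gt0.
have Pp : 0 < extensive (rgas G) up by rewrite extensive_rgas // mulr_gt0.
rewrite (extensive_spart hCv hgam _ nm Pm) (extensive_spart hCv hgam _ np Pp).
have J := extensive_rgas_jump n am ap def.
have T := logmean_jump tm0 tp0; have t0 := logmean_neq0 tm0 tp0.
rewrite energy_hec rho_hec momentum_hec !pres_theta //.
set h := h_rho _ _ _; set p := avg (_ * mixr _ _) _ / _.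
have ET : p * (theta G um + theta G up) =
    rho um * mixr G (Yof um) + rho up * mixr G (Yof up).
  by rewrite /p /avg; field; rewrite gt_eqF // addr_gt0.
rewrite !dotvDr !(dotvZr h) !(dotvZr p) !(dotvC _ (avgv _ _)) !dotv_avgv in J *.
rewrite (dotvC (vel up) (vel um)).
set t := logmean _ _ in T t0 *.
have T' : ln (theta G up) - ln (theta G um) = (theta G up - theta G um) / t.
  by rewrite -T mulrC mulKf.
set lhs := (X in X = _).
(* The kinetic terms multiplying [h] vanish on each side separately, because v^-.v^+ / 2 - v.vbar +
   v.v / 2 = 0 for v equal to v^- or v^+. The last summand is zero by [T']. *)
have -> : lhs = extensive (rgas G) (hec G um up n)
      * (ln (extensive (rgas G) up) - ln (extensive (rgas G) um))
    + p * (theta G um + theta G up) * (dotv (vel up) n - dotv (vel um) n) / 2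
    + extensive (Cv G) (hec G um up n) * (ln (theta G up) - ln (theta G um)
        - (theta G up - theta G um) / t).
  by rewrite /lhs /avg; clearbody p; field.
(* What remains is the product rule for jumps applied to rho r and v.n. *)
by rewrite J ET T' subrr /avg; field.
Qed.

End NumericalFlux.

Theorem lemma3p1 (R : realType) (m d : nat) (hm : (1 <= m)%N) (hd : (1 <= d)%N)
    (G : mixture R m)
    (hCv : forall i, 0 < Cv G i) (hgam : forall i, 1 < gam G i)
    (n : 'cV[R]_d) (hn : dotv n n = 1) :
  [/\ forall um up : state R m d, admissible um -> admissible up ->
        hec G um up n = hec G up um n,
      forall u : state R m d, admissible u -> hec_defined G u u ->
        hec G u u n = flux G u *m n
    & forall um up : state R m d, admissible um -> admissible up ->
        hec_defined G um up ->
        dotv (jump (entropy_var G um) (entropy_var G up)) (hec G um up n)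
        = dotv (jump (potential G um) (potential G up)) n].
Proof.
split=> [um up _ _|u adm def|um up am ap def]; first exact: hecC.
  exact: hec_consistent.
exact: hec_conservative.
Qed.
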